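(* The function $x\mapsto \dfrac{\zeta(x)+\zeta(1/x)}{\zeta(x)\zeta(1/x)}$ is strictly increasing on $(0,1)$ and strictly decreasing on $(1,+\infty)$, and for all real $x>0$ with $x\neq 1$, $$H\big(\zeta(x),\zeta(1/x)\big)<-2.$$ Equality corresponds to the limiting case $x=0$, i.e. $\lim_{x\to 0^+}H\big(\zeta(x),\zeta(1/x)\big)=-2$.
   Context: $\zeta$ is the Riemann zeta function (meromorphically continued, with its only pole at $1$). $H(a,b)=\frac{2ab}{a+b}$ is the harmonic mean of real numbers $a,b$ with $a+b\neq 0$. *)

(* Defs.v *)
From Stdlib Require Import Reals.
From Coquelicot Require Import Coquelicot.
Open Scope R_scope.

Definition Cexp (z : C) : C :=
  (exp (Re z) * cos (Im z), exp (Re z) * sin (Im z)).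

(* [a] to the complex power [s], meaningful for [a > 0] only. *)
Definition Rcpow (a : R) (s : C) : C := Cexp (s * RtoC (ln a)).

Definition analytic_at (f : C -> C) (z : C) : Prop :=
  exists (a : nat -> C) (r : R), 0 < r /\
    forall w : C, Cmod (w - z) < r ->
      is_pseries (K := C_AbsRing) (V := C_NormedModule) a (w - z)%C (f w).

(* The value of [f] at [z] itself is not constrained, so [f] may have a pole
   there; analyticity at [z] is the case of [m = 0] and [g z = f z]. *)
Definition meromorphic_at (f : C -> C) (z : C) : Prop :=
  exists (m : nat) (g : C -> C) (r : R), analytic_at g z /\ 0 < r /\
    forall w : C, 0 < Cmod (w - z) < r -> g w = ((w - z) ^ m * f w)%C.

(* These clauses determine [zeta] on [C] minus [{1}] (identity theorem); its
   value at the pole [1] is arbitrary. *)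
Definition is_Riemann_zeta (zeta : C -> C) : Prop :=
  (forall s : C, 1 < Re s ->
     is_series (K := C_AbsRing) (V := C_NormedModule)
       (fun n : nat => Rcpow (INR (S n)) (- s)) (zeta s)) /\
  (forall s : C, s <> RtoC 1 -> analytic_at zeta s) /\
  meromorphic_at zeta (RtoC 1).

(* For functions that, like the Riemann zeta function, take real values on the
   real axis: the real part then loses nothing. *)
Definition on_reals (f : C -> C) (x : R) : R := Re (f (RtoC x)).

Definition harmonic_mean (a b : R) : R := 2 * a * b / (a + b).

(* Main.v *)
(* Write [phi t = {t} (1 - {t}) / 2] and [Phi s] for the integral of [phi t * t^(-s-2)] over
   [1, oo). Euler-Maclaurin gives [zeta s = 1/(s-1) + 1/2 + s (s+1) Phi s], first for [s > 1],
   then on (0, 1) by the identity theorem, since [Phi] is analytic on (0, oo). Hence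
   [1 / zeta s = 2 (s-1)/(s+1) / (1 + 2 s (s-1) Phi s)], whose leading factor changes sign
   under [s -> 1/s]. So [1/zeta x + 1/zeta (1/x)] equals
   [-2 (1-x)/(1+x) (1/(1-p) - 1/(1+e))] on (0, 1), with [p = 2 x (1-x) Phi x] and
   [e = 2 y (y-1) Phi y], [y = 1/x]. It increases because [Phi] is decreasing and small, and
   because [y (y-1) Phi y] is increasing for [y > 1]. The latter comes from a single-crossing
   comparison of [phi] with the weight [1 - 1/t], whose transform is [1/((y+1)(y+2))]. *)

(* The delicate range is small [x]. With [w = (1-x)/(1+x)], the quantity to be shown decreasing
   splits as [w p/(1-p) + w (1 - 1/(1+e))]. The second summand decreases, but the first is positive
   and vanishes at both ends of (0, 1), so it has to grow near 0. That growth is absorbed by the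
   fall of the second summand, and what permits this is no estimate of [Phi] but the trivial bound
   [zeta (1/x) >= 1], which reads [1 + e >= 2 w]. The two regimes meet at [x = 1/3], where
   [2 w = 1]. No derivative of [Phi] is ever taken. Over a pair [a < b] the value of [Phi] is frozen
   at [a], which turns the first summand into an explicit rational function. The reference weight
   [1 - 1/t] is chosen because on [1, 2] the ratio of the kernel to it is [(1 - (t-1)^2)/2], which
   decreases from 1/2 to 0: every level in between is crossed exactly once. *)
Require Import Defs.
From Stdlib Require Import Reals Lra Lia Factorial Classical.
From Coquelicot Require Import Coquelicot.
Open Scope R_scope.

(* Coquelicot's structures leave equations at types that [ring] and [field] do not see to be [R]. *)
Ltac real_eq := match goal with |- @eq _ ?x ?y => change (@eq R x y) end.

(** * The kernel, its transform [Phi], and bounds uniform in the exponent *)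

(* The Bernoulli-type kernel [{t} (1 - {t}) / 2] on [n+1, n+2]: series indices start at 0. *)
Definition bern (n : nat) (t : R) : R := (t - INR (S n)) * (INR (S n) + 1 - t) / 2.

Definition Phi_n (n : nat) (s : R) : R :=
  RInt (fun t => bern n t * Rpower t (- s - 2)) (INR (S n)) (INR (S n) + 1).

(** Cutting [1, oo) at the integers leaves only proper integrals of smooth functions, and every
    exchange of limits becomes one about series. *)
Definition Phi (s : R) : R := Series (fun n => Phi_n n s).

Lemma INR_S_ge_1 (n : nat) : 1 <= INR (S n).
Proof. rewrite S_INR; pose proof (pos_INR n); lra. Qed.

Lemma bern_bounds (n : nat) (t : R) :
  INR (S n) <= t <= INR (S n) + 1 -> 0 <= bern n t <= 1 / 8.
Proof.
intros H; unfold bern; split; [|pose proof (pow2_ge_0 (t - INR (S n) - / 2)); nra].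
apply Rmult_le_pos; [apply Rmult_le_pos|]; lra.
Qed.

Lemma Rpower_pos (x y : R) : 0 < Rpower x y.
Proof. apply exp_pos. Qed.

Lemma continuous_Rpower_l (a t : R) : 0 < t -> continuous (fun u => Rpower u a) t.
Proof.
intros Ht; apply (ex_derive_continuous (V := R_NormedModule)).
unfold Rpower; auto_derive; lra.
Qed.

Lemma continuous_bern (n : nat) (t : R) : continuous (bern n) t.
Proof.
apply (ex_derive_continuous (V := R_NormedModule)); unfold bern; auto_derive; trivial.
Qed.

Lemma ex_RInt_unit (f : R -> R) (n : nat) :
  (forall t, 0 < t -> continuous f t) -> ex_RInt f (INR (S n)) (INR (S n) + 1).
Proof.
intros Hf; apply (ex_RInt_continuous (V := R_CompleteNormedModule)).
intros t; rewrite Rmin_left, Rmax_right by lra; intros Ht.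
apply Hf; pose proof (INR_S_ge_1 n); lra.
Qed.

Lemma continuous_bern_Rpower (n : nat) (a t : R) :
  0 < t -> continuous (fun u => bern n u * Rpower u a) t.
Proof.
intros Ht; apply (continuous_mult (K := R_AbsRing)).
- apply continuous_bern.
- now apply continuous_Rpower_l.
Qed.

Lemma ex_RInt_bern_Rpower (n : nat) (a : R) :
  ex_RInt (fun t => bern n t * Rpower t a) (INR (S n)) (INR (S n) + 1).
Proof. apply ex_RInt_unit; intros t; apply continuous_bern_Rpower. Qed.

Lemma is_RInt_antiderivative (f df : R -> R) (a b : R) :
  a <= b -> (forall t, a <= t <= b -> is_derive f t (df t)) ->
  (forall t, a <= t <= b -> continuous df t) -> is_RInt df a b (f b - f a).
Proof.
intros Hab Hf Hc; apply (is_RInt_derive (V := R_CompleteNormedModule));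
  intros t; rewrite Rmin_left, Rmax_right by lra; auto.
Qed.

Lemma Phi_n_gt_0 (n : nat) (s : R) : 0 < Phi_n n s.
Proof.
apply RInt_gt_0; [lra| |].
- intros t Ht; apply Rmult_lt_0_compat; [|apply Rpower_pos].
  apply Rmult_lt_0_compat; [apply Rmult_lt_0_compat|]; lra.
- intros t Ht; apply continuous_bern_Rpower; pose proof (INR_S_ge_1 n); lra.
Qed.

Lemma Phi_n_decr (n : nat) (s s' : R) : s <= s' -> Phi_n n s' <= Phi_n n s.
Proof.
intros Hs; apply RInt_le; try apply ex_RInt_bern_Rpower; [lra|].
intros t Ht; pose proof (INR_S_ge_1 n).
apply Rmult_le_compat_l; [apply bern_bounds; lra|].
apply Rle_Rpower; lra.
Qed.

(** The kernel is at most 1/8 and [t^(-s-2) <= t^-2]. The resulting bound does not depend on [s] and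
    telescopes, so it gives both convergence and [Phi <= 1/8]. *)
Lemma Phi_n_le (n : nat) (s : R) :
  0 <= s -> Phi_n n s <= / 8 * (/ INR (S n) - / INR (S (S n))).
Proof.
intros Hs; pose proof (INR_S_ge_1 n).
assert (HI : is_RInt (fun t => / 8 * / t ^ 2) (INR (S n)) (INR (S n) + 1)
               (/ 8 * (/ INR (S n) - / INR (S (S n))))).
{ rewrite (S_INR (S n)).
  replace (/ 8 * _) with (- / 8 * / (INR (S n) + 1) - - / 8 * / INR (S n)) by (field; lra).
  apply (is_RInt_antiderivative (fun t => - / 8 * / t)); [lra| |].
  - intros t Ht; auto_derive; [lra|field; lra].
  - intros t Ht; apply (ex_derive_continuous (V := R_NormedModule)).
    auto_derive; apply Rgt_not_eq; nra. }
rewrite <- (is_RInt_unique _ _ _ _ HI).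
apply RInt_le; [lra|apply ex_RInt_bern_Rpower|eexists; exact HI|].
intros t Ht; replace (/ 8) with (1 / 8) by lra.
apply Rmult_le_compat; [apply bern_bounds; lra|left; apply Rpower_pos|apply bern_bounds; lra|].
replace (/ t ^ 2) with (Rpower t (- 0 - 2)).
- apply Rle_Rpower; lra.
- replace (- 0 - 2) with (- INR 2) by (cbn; ring).
  rewrite Rpower_Ropp, Rpower_pow by lra; reflexivity.
Qed.

Lemma is_series_telescope (f : nat -> R) (l : R) :
  is_lim_seq f l -> is_series (fun n => f n - f (S n)) (f 0%nat - l).
Proof.
intros Hf; change (is_lim_seq (sum_n (fun n => f n - f (S n))) (f 0%nat - l)).
apply is_lim_seq_ext with (fun n => f 0%nat - f (S n)).
- induction n as [|n IH]; [now rewrite sum_O|].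
  rewrite sum_Sn, <- IH; unfold plus; cbn; ring.
- apply is_lim_seq_minus'; [apply is_lim_seq_const|now apply is_lim_seq_incr_1 in Hf].
Qed.

Lemma is_lim_seq_inv_INR_S : is_lim_seq (fun n => / INR (S n)) 0.
Proof.
apply (is_lim_seq_incr_1 (fun n => / INR n)).
replace (Finite 0) with (Rbar_inv p_infty) by reflexivity.
apply is_lim_seq_inv; [apply is_lim_seq_INR|easy].
Qed.

Lemma is_series_Phi_bound :
  is_series (fun n => / 8 * (/ INR (S n) - / INR (S (S n)))) (1 / 8).
Proof.
replace (1 / 8) with (/ 8 * (/ INR 1 - 0)) by (simpl; field).
apply (is_series_scal (K := R_AbsRing) (V := R_NormedModule) (/ 8)
         (fun n => / INR (S n) - / INR (S (S n)))).
apply (is_series_telescope (fun n => / INR (S n))), is_lim_seq_inv_INR_S.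
Qed.

Lemma ex_series_Phi (s : R) : 0 <= s -> ex_series (fun n => Phi_n n s).
Proof.
intros Hs; apply (ex_series_le (K := R_AbsRing) (V := R_CompleteNormedModule))
  with (fun n => / 8 * (/ INR (S n) - / INR (S (S n)))).
- intros n; change (Rabs (Phi_n n s) <= / 8 * (/ INR (S n) - / INR (S (S n)))).
  rewrite Rabs_pos_eq; [now apply Phi_n_le|left; apply Phi_n_gt_0].
- eexists; apply is_series_Phi_bound.
Qed.

Lemma Phi_le (s : R) : 0 <= s -> Phi s <= 1 / 8.
Proof.
intros Hs; rewrite <- (is_series_unique _ _ is_series_Phi_bound).
apply Series_le; [|eexists; apply is_series_Phi_bound].
intros n; split; [left; apply Phi_n_gt_0|now apply Phi_n_le].
Qed.

Lemma sum_n_le_Series (a : nat -> R) (N : nat) :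
  (forall n, 0 <= a n) -> ex_series a -> sum_n a N <= Series a.
Proof.
intros Ha Hex; apply (is_lim_seq_incr_compare (sum_n a)).
- apply (Series_correct _ Hex).
- intros n; rewrite sum_Sn; unfold plus; cbn; specialize (Ha (S n)); lra.
Qed.

Lemma Phi_gt_0 (s : R) : 0 <= s -> 0 < Phi s.
Proof.
intros Hs; apply Rlt_le_trans with (sum_n (fun n => Phi_n n s) 0).
- rewrite sum_O; apply Phi_n_gt_0.
- apply sum_n_le_Series; [intros n; left; apply Phi_n_gt_0|now apply ex_series_Phi].
Qed.

Lemma Phi_decr (s s' : R) : 0 <= s -> s <= s' -> Phi s' <= Phi s.
Proof.
intros Hs Hss; apply Series_le; [|now apply ex_series_Phi].
intros n; split; [left; apply Phi_n_gt_0|now apply Phi_n_decr].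
Qed.

(** * Euler-Maclaurin formula *)

Lemma Rpower_minus_nat (t a : R) (k : nat) :
  0 < t -> Rpower t (a - INR k) * t ^ k = Rpower t a.
Proof.
intros Ht; rewrite <- (Rpower_pow k t Ht), <- Rpower_plus; f_equal; ring.
Qed.

Lemma Rpower_1_l (a : R) : Rpower 1 a = 1.
Proof. unfold Rpower; rewrite ln_1, Rmult_0_r; apply exp_0. Qed.

(* The trapezoid rule for [t^-s] on [n+1, n+2], with Peano kernel [bern n]. *)
Lemma Phi_n_closed (n : nat) (s : R) : s <> 1 ->
  s * (s + 1) * Phi_n n s =
    (Rpower (INR (S n)) (- s) + Rpower (INR (S (S n))) (- s)) / 2
    + (Rpower (INR (S (S n))) (1 - s) - Rpower (INR (S n)) (1 - s)) / (s - 1).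
Proof.
intros Hs; pose proof (INR_S_ge_1 n) as Hn.
set (m := INR (S n)) in *.
(* Two integrations by parts; the second derivative of the kernel is -1, which produces the term in
   [1/(s-1)]. *)
pose (G := fun t => Rpower t (- s - 2) *
  (- s * bern n t * t - (m + / 2 - t) * t ^ 2 + t ^ 3 / (s - 1))).
assert (HI : is_RInt (fun t => s * (s + 1) * (bern n t * Rpower t (- s - 2)))
               m (m + 1) (G (m + 1) - G m)).
{ apply is_RInt_antiderivative; [lra| |].
  - intros t Ht; unfold G, Rpower, bern; fold m; auto_derive; [lra|field; lra].
  - intros t Ht; apply (continuous_scal_r (K := R_AbsRing) (V := R_NormedModule)).
    apply continuous_bern_Rpower; lra. }
replace (s * (s + 1) * Phi_n n s) with (G (m + 1) - G m).
2:{ rewrite <- (is_RInt_unique _ _ _ _ HI); apply is_RInt_unique.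
  apply (is_RInt_scal (V := R_NormedModule)), (RInt_correct (V := R_CompleteNormedModule)).
  apply ex_RInt_bern_Rpower. }
rewrite (S_INR (S n)); fold m; unfold G, bern; fold m.
(* All powers of [m] and of [m + 1] are reduced to the exponent [-s-2], so that [field] meets one
   atom for each base. *)
rewrite <- (Rpower_minus_nat m (- s) 2), <- (Rpower_minus_nat (m + 1) (- s) 2),
 <- (Rpower_minus_nat m (1 - s) 3), <- (Rpower_minus_nat (m + 1) (1 - s) 3) by lra.
replace (- s - INR 2) with (- s - 2) by (simpl; ring).
replace (1 - s - INR 3) with (- s - 2) by (simpl; ring).
field; lra.
Qed.

(** Each interior integer receives half its term from either side. The last trapezoid ends at
    [N + 2], one beyond the last summand, hence the subtracted half term; the endpoint 1 contributes
    [1/2] and [1/(s-1)]. *)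
Lemma sum_n_Rpower (s : R) (N : nat) : s <> 1 ->
  sum_n (fun n => Rpower (INR (S n)) (- s)) N =
    s * (s + 1) * sum_n (fun n => Phi_n n s) N + / 2
    - Rpower (INR (S (S N))) (- s) / 2
    + (1 - Rpower (INR (S (S N))) (1 - s)) / (s - 1).
Proof.
intros Hs; induction N as [|N IH].
- rewrite !sum_O, Phi_n_closed by assumption.
  real_eq.
  change (INR 1) with 1; rewrite !Rpower_1_l; field; lra.
- rewrite !sum_Sn, IH; change (@plus R_AbelianMonoid) with Rplus.
  real_eq.
  rewrite (Rmult_plus_distr_l (s * (s + 1))), (Phi_n_closed (S N)) by assumption; field; lra.
Qed.

Lemma is_lim_seq_Rpower_neg (a : R) :
  a < 0 -> is_lim_seq (fun n => Rpower (INR (S n)) a) 0.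
Proof.
intros Ha; apply (is_lim_seq_incr_1 (fun n => Rpower (INR n) a)).
apply (is_lim_comp_seq (fun x => Rpower x a) INR p_infty 0).
- unfold Rpower; apply is_lim_comp with m_infty.
  + apply is_lim_exp_m.
  + replace m_infty with (Rbar_mult a p_infty).
    * apply is_lim_scal_l, is_lim_ln_p.
    * simpl; destruct (Rle_dec 0 a); [exfalso; lra|reflexivity].
  + now exists 0.
- now exists 0%nat.
- apply is_lim_seq_INR.
Qed.

Definition zeta_EM (s : R) : R := 1 / (s - 1) + 1 / 2 + s * (s + 1) * Phi s.

Lemma is_series_zeta_EM (s : R) :
  1 < s -> is_series (fun n => Rpower (INR (S n)) (- s)) (zeta_EM s).
Proof.
intros Hs; change (is_lim_seq (sum_n (fun n => Rpower (INR (S n)) (- s))) (zeta_EM s)).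
eapply is_lim_seq_ext; [intros N; symmetry; apply sum_n_Rpower; lra|].
replace (zeta_EM s) with (s * (s + 1) * Phi s + / 2 - 0 / 2 + (1 - 0) / (s - 1))
  by (unfold zeta_EM; field; lra).
assert (Hl : forall a, a < 0 -> is_lim_seq (fun N => Rpower (INR (S (S N))) a) 0).
{ intros a Ha; apply (is_lim_seq_incr_1 (fun N => Rpower (INR (S N)) a)).
  now apply is_lim_seq_Rpower_neg. }
apply is_lim_seq_plus'; [apply is_lim_seq_minus'; [apply is_lim_seq_plus'|]|].
- apply (is_lim_seq_scal_l _ _ (Phi s)), (Series_correct _ (ex_series_Phi s ltac:(lra))).
- apply is_lim_seq_const.
- apply (is_lim_seq_scal_r _ (/ 2) 0), Hl; lra.
- apply (is_lim_seq_scal_r _ (/ (s - 1)) (1 - 0)).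
  apply is_lim_seq_minus'; [apply is_lim_seq_const|apply Hl; lra].
Qed.

(** The first term of the Dirichlet series is already 1. Read through the Euler-Maclaurin form, this
    controls the second defect from below near [x = 0]. *)
Lemma zeta_EM_ge_1 (s : R) : 1 < s -> 1 <= zeta_EM s.
Proof.
intros Hs; pose proof (is_series_zeta_EM s Hs) as HS.
rewrite <- (is_series_unique _ _ HS).
apply Rle_trans with (sum_n (fun n => Rpower (INR (S n)) (- s)) 0).
- rewrite sum_O; change (INR 1) with 1; rewrite Rpower_1_l; lra.
- apply sum_n_le_Series; [intros n; left; apply Rpower_pos|eexists; exact HS].
Qed.

(** * Power series of Phi *)

Lemma Rabs_sum_n (a b : nat -> R) (N : nat) :
  (forall n, Rabs (a n) <= b n) -> Rabs (sum_n a N) <= sum_n b N.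
Proof.
intros H; induction N as [|N IH]; [rewrite !sum_O; apply H|].
rewrite !sum_Sn; change (@plus R_AbelianMonoid) with Rplus.
eapply Rle_trans; [apply Rabs_triang|]; specialize (H (S N)); lra.
Qed.

Lemma Rabs_series_tail_le (a b : nat -> R) (la lb : R) (K : nat) :
  (forall k, Rabs (a k) <= b k) -> is_series a la -> is_series b lb ->
  Rabs (la - sum_n a K) <= lb - sum_n b K.
Proof.
intros Hab Ha Hb.
change (is_lim_seq (sum_n a) la) in Ha; change (is_lim_seq (sum_n b) lb) in Hb.
apply (is_lim_seq_le_loc (fun N => Rabs (sum_n a N - sum_n a K))
         (fun N => sum_n b N - sum_n b K) (Rabs (la - sum_n a K)) (lb - sum_n b K)).
- exists K; intros N HN.
  replace N with (K + (N - K))%nat by lia; induction (N - K)%nat as [|j IH].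
  + rewrite Nat.add_0_r, !Rminus_diag, Rabs_R0; lra.
  + rewrite Nat.add_succ_r, !sum_Sn; change (@plus R_AbelianMonoid) with Rplus.
    specialize (Hab (S (K + j))).
    replace (sum_n a (K + j) + a (S (K + j)) - sum_n a K)
      with (sum_n a (K + j) - sum_n a K + a (S (K + j))) by ring.
    eapply Rle_trans; [apply Rabs_triang|]; lra.
- apply (is_lim_seq_abs _ (la - sum_n a K)), is_lim_seq_minus'; [exact Ha|apply is_lim_seq_const].
- apply is_lim_seq_minus'; [exact Hb|apply is_lim_seq_const].
Qed.

(** Dominated convergence for series: cut at an [N] where the tail of [M] is below [eps/4]; the two
    tails and the difference of the heads then add up to less than [eps]. *)
Lemma Tannery (u : nat -> nat -> R) (v : nat -> R) (M : nat -> R) :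
  ex_series M -> (forall n K, Rabs (u n K) <= M n) ->
  (forall n, is_lim_seq (u n) (v n)) ->
  is_lim_seq (fun K => Series (fun n => u n K)) (Series v).
Proof.
intros HM Hu Hv.
assert (Hv' : forall n, Rabs (v n) <= M n).
{ intros n; apply (is_lim_seq_le (fun K => Rabs (u n K)) (fun _ => M n) (Rabs (v n)) (M n)).
  - intros K; apply Hu.
  - apply (is_lim_seq_abs _ (v n)), Hv.
  - apply is_lim_seq_const. }
assert (Hex : forall a, (forall n, Rabs (a n) <= M n) -> is_series a (Series a)).
{ intros a Ha; apply Series_correct.
  now apply (ex_series_le (K := R_AbsRing) (V := R_CompleteNormedModule) a M). }
apply Series_correct in HM.
apply is_lim_seq_spec; intros eps.
assert (He : 0 < eps / 4) by (destruct eps; simpl; lra).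
change (is_lim_seq (sum_n M) (Series M)) in HM.
pose proof HM as HM'; apply is_lim_seq_spec in HM'; destruct (HM' (mkposreal _ He)) as [N HN].
specialize (HN N (le_n N)); simpl in HN; apply Rabs_def2 in HN.
assert (HS : is_lim_seq (fun K => sum_n (fun n => u n K) N) (sum_n v N)).
{ clear HN; induction N as [|N IH].
  - apply is_lim_seq_ext with (u 0%nat); [intros; now rewrite sum_O|rewrite sum_O; apply Hv].
  - rewrite sum_Sn.
    apply is_lim_seq_ext with (fun K => sum_n (fun n => u n K) N + u (S N) K);
      [intros; now rewrite sum_Sn|].
    now apply is_lim_seq_plus'. }
apply is_lim_seq_spec in HS; destruct (HS (mkposreal _ He)) as [K0 HK].
exists K0; intros K HKK; specialize (HK K HKK); simpl in HK.
pose proof (Rabs_series_tail_le _ _ _ _ N (fun n => Hu n K) (Hex _ (fun n => Hu n K)) HM) as T1.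
pose proof (Rabs_series_tail_le _ _ _ _ N Hv' (Hex _ Hv') HM) as T2.
revert T1 T2 HK; unfold Rabs; repeat destruct Rcase_abs; destruct eps; simpl in *; lra.
Qed.

Lemma Series_sum_n (a : nat -> nat -> R) (K : nat) :
  (forall k, ex_series (fun n => a n k)) ->
  Series (fun n => sum_n (a n) K) = sum_n (fun k => Series (fun n => a n k)) K /\
  ex_series (fun n => sum_n (a n) K).
Proof.
intros Ha; induction K as [|K [IH1 IH2]].
- split.
  + rewrite sum_O; apply Series_ext; intros n; now rewrite sum_O.
  + eapply ex_series_ext; [|apply (Ha 0%nat)]; intros n; now rewrite sum_O.
- assert (E : forall n, sum_n (a n) K + a n (S K) = sum_n (a n) (S K)).
  { intros n; now rewrite sum_Sn. }
  split.
  + rewrite sum_Sn, <- IH1, <- (Series_ext _ _ E); apply Series_plus; auto.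
  + eapply ex_series_ext; [exact E|]; apply (ex_series_plus (V := R_NormedModule)); auto.
Qed.

(** Summing over [k] first up to [K] commutes with the sum over [n]; letting [K] grow is [Tannery],
    with the row sums [B] of the majorant as dominating sequence. *)
Lemma is_series_Fubini (a b : nat -> nat -> R) (A B : nat -> R) :
  (forall n k, Rabs (a n k) <= b n k) ->
  (forall n, is_series (a n) (A n)) -> (forall n, is_series (b n) (B n)) ->
  ex_series B -> is_series (fun k => Series (fun n => a n k)) (Series A).
Proof.
intros Hab HA HB HexB.
assert (Hb : forall n k, 0 <= b n k).
{ intros n k; eapply Rle_trans; [apply Rabs_pos|apply Hab]. }
assert (Hsum : forall n K, sum_n (b n) K <= B n).
{ intros n K; rewrite <- (is_series_unique _ _ (HB n)).
  apply sum_n_le_Series; [apply Hb|eexists; apply HB]. }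
assert (Hle : forall n k, b n k <= B n).
{ intros n k; eapply Rle_trans; [|apply (Hsum n k)]; destruct k as [|k].
  - rewrite sum_O; lra.
  - rewrite sum_Sn; change (@plus R_AbelianMonoid) with Rplus.
    enough (0 <= sum_n (b n) k) by lra.
    clear -Hb; induction k as [|k IH]; [rewrite sum_O; apply Hb|].
    rewrite sum_Sn; change (@plus R_AbelianMonoid) with Rplus; specialize (Hb n (S k)); lra. }
change (is_lim_seq (sum_n (fun k => Series (fun n => a n k))) (Series A)).
apply is_lim_seq_ext with (fun K => Series (fun n => sum_n (a n) K)).
- intros K; apply Series_sum_n; intros k.
  apply (ex_series_le (K := R_AbsRing) (V := R_CompleteNormedModule) _ B); [|assumption].
  intros n; eapply Rle_trans; [apply Hab|apply Hle].
- apply Tannery with B; [assumption| |exact HA].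
  intros n K; eapply Rle_trans; [apply Rabs_sum_n, Hab|apply Hsum].
Qed.

(* Expansion of [t^h = exp (h ln t)] under the integral sign. *)
Lemma is_pseries_Phi_n (n : nat) (c h : R) :
  is_pseries (fun k => RInt (fun t => bern n t * Rpower t (- c - 2) * (ln t ^ k / INR (fact k)))
                        (INR (S n)) (INR (S n) + 1)) h
    (Phi_n n (c - h)).
Proof.
pose proof (INR_S_ge_1 n) as Hn; set (m := INR (S n)) in *.
set (f := fun k t => bern n t * Rpower t (- c - 2) * (ln t ^ k / INR (fact k))).
assert (Hc : forall k t, 0 < t -> continuous (f k) t).
{ intros k t Ht; apply (continuous_mult (K := R_AbsRing)).
  - now apply continuous_bern_Rpower.
  - apply (ex_derive_continuous (V := R_NormedModule)); auto_derive; trivial. }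
set (e := fun K x => sum_n (fun k => x ^ k / INR (fact k)) K).
set (B := Rpower (m + 1) (Rabs (- c - 2))).
set (L := ln (m + 1)); set (X := Rabs h * L).
assert (HL : 0 <= L) by (unfold L; rewrite <- ln_1; apply ln_le; lra).
assert (Hexp : forall x, is_series (fun k => x ^ k / INR (fact k)) (exp x)).
{ intros x; generalize (is_exp_Reals x); unfold is_pseries; apply is_series_ext.
  intros k; rewrite pow_n_pow; reflexivity. }
assert (HS : forall K, is_RInt (fun t => sum_n (fun k => h ^ k * f k t) K) m (m + 1)
    (sum_n (fun k => h ^ k * RInt (f k) m (m + 1)) K)).
{ assert (H1 : forall k, is_RInt (fun t => h ^ k * f k t) m (m + 1) (h ^ k * RInt (f k) m (m + 1))).
  { intros k; apply (is_RInt_scal (V := R_NormedModule)).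
    apply (RInt_correct (V := R_CompleteNormedModule)), ex_RInt_unit, Hc. }
  induction K as [|K IH].
  - rewrite sum_O; eapply is_RInt_ext; [|apply (H1 0%nat)].
    intros t _; now rewrite sum_O.
  - rewrite sum_Sn.
    apply (is_RInt_ext (fun t => plus (sum_n (fun k => h ^ k * f k t) K) (h ^ S K * f (S K) t))).
    + intros t _; now rewrite sum_Sn.
    + apply (is_RInt_plus (V := R_NormedModule)); auto. }
assert (HP : is_RInt (fun t => bern n t * Rpower t (- (c - h) - 2)) m (m + 1) (Phi_n n (c - h))).
{ apply (RInt_correct (V := R_CompleteNormedModule)), ex_RInt_bern_Rpower. }
(* On the unit interval [0 <= ln t <= L], so the Taylor remainder of [exp (h ln t)] is at most that
   of [exp X], whatever [t] is. This uniform bound integrates to itself over length 1. *)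
assert (Hrem : forall K, Rabs (sum_n (fun k => h ^ k * RInt (f k) m (m + 1)) K - Phi_n n (c - h))
    <= B * (exp X - e K X)).
{ intros K.
  replace (B * _) with ((m + 1 - m) * (B * (exp X - e K X))) by (real_eq; ring).
  apply (norm_RInt_le_const (V := R_NormedModule)
    (fun t => minus (sum_n (fun k => h ^ k * f k t) K)
       (bern n t * Rpower t (- (c - h) - 2))) m (m + 1)).
  - lra.
  - intros t Ht.
    assert (Hlt : 0 <= ln t <= L).
    { unfold L; split; [rewrite <- ln_1|]; apply ln_le; lra. }
    assert (E : sum_n (fun k => h ^ k * f k t) K =
              bern n t * Rpower t (- c - 2) * e K (h * ln t)).
    { unfold e; rewrite <- (sum_n_mult_l (K := R_Ring)); apply sum_n_ext; intros k; unfold f.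
      change (@mult R_Ring) with Rmult; rewrite Rpow_mult_distr; unfold Rdiv; real_eq; ring. }
    rewrite E.
    replace (Rpower t (- (c - h) - 2)) with (Rpower t (- c - 2) * exp (h * ln t))
      by (unfold Rpower; rewrite <- exp_plus; f_equal; ring).
    match goal with |- norm (minus ?x ?y) <= _ =>
      change (Rabs (x - y) <= B * (exp X - e K X)) end.
    match goal with |- Rabs ?x <= _ => replace x with
      (bern n t * Rpower t (- c - 2) * - (exp (h * ln t) - e K (h * ln t)))
      by (real_eq; ring) end.
    rewrite Rabs_mult, Rabs_Ropp; apply Rmult_le_compat; try apply Rabs_pos.
    + pose proof (bern_bounds n t Ht); rewrite Rabs_pos_eq
        by (apply Rmult_le_pos; [lra|left; apply Rpower_pos]).
      rewrite <- (Rmult_1_l B).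
      apply Rmult_le_compat; [lra|left; apply Rpower_pos|lra|].
      apply Rle_trans with (Rpower t (Rabs (- c - 2))).
      * apply Rle_Rpower; [lra|apply Rle_abs].
      * apply Rle_Rpower_l; [apply Rabs_pos|lra].
    + apply Rabs_series_tail_le; [|apply Hexp|apply Hexp].
      intros k; unfold Rdiv; rewrite Rabs_mult, <- RPow_abs.
      rewrite (Rabs_pos_eq (/ _)) by (left; apply Rinv_0_lt_compat, INR_fact_lt_0).
      apply Rmult_le_compat_r; [left; apply Rinv_0_lt_compat, INR_fact_lt_0|].
      apply pow_incr; split; [apply Rabs_pos|].
      rewrite Rabs_mult, (Rabs_pos_eq (ln t)) by lra.
      apply Rmult_le_compat_l; [apply Rabs_pos|lra].
  - apply (is_RInt_minus (V := R_NormedModule)); [apply HS|exact HP]. }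
unfold is_pseries.
apply (is_series_ext (fun k => h ^ k * RInt (f k) m (m + 1))).
{ intros k; real_eq; rewrite <- (pow_n_pow h k); reflexivity. }
change (is_lim_seq (sum_n (fun k => h ^ k * RInt (f k) m (m + 1))) (Phi_n n (c - h))).
set (D := fun K => sum_n (fun k => h ^ k * RInt (f k) m (m + 1)) K - Phi_n n (c - h)).
apply is_lim_seq_ext with (fun K => D K + Phi_n n (c - h)); [intros K; unfold D; simpl; ring|].
replace (Finite (Phi_n n (c - h))) with (Finite (0 + Phi_n n (c - h))) by (f_equal; ring).
apply is_lim_seq_plus'; [|apply is_lim_seq_const].
apply is_lim_seq_abs_0.
apply (is_lim_seq_le_le (fun _ => 0) _ (fun K => B *
  (exp X - e K X))).
- intros K; split; [apply Rabs_pos|apply Hrem].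
- apply is_lim_seq_const.
- replace (Finite 0) with (Finite (B * (exp X - exp X)))
    by (f_equal; ring).
  apply (is_lim_seq_scal_l _ _ (exp X - exp X)).
  apply is_lim_seq_minus'; [apply is_lim_seq_const|apply Hexp].
Qed.

(** * Identity theorem and continuation of zeta *)

(** The identity theorem is only run along the real axis, so complex analyticity enters through this
    restriction. *)
Definition real_analytic_at (f : R -> R) (x : R) : Prop :=
  exists (a : nat -> R) (r : R), 0 < r /\
    forall h, Rabs h < r -> is_pseries a h (f (x + h)).

(** The series still converges at the midpoint between [|h|] and [r], which makes the inequality
    strict; the product of power series requires strictness. *)
Lemma CV_radius_gt (a : nat -> R) (f : R -> R) (r h : R) :
  (forall h, Rabs h < r -> is_pseries a h (f h)) -> Rabs h < r ->
  Rbar_lt (Rabs h) (CV_radius a).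
Proof.
intros Hf Hh.
apply Rbar_lt_le_trans with (Finite ((Rabs h + r) / 2)); [simpl; lra|].
pose proof (Rabs_pos h).
assert (Hq : Rabs ((Rabs h + r) / 2) = (Rabs h + r) / 2) by (apply Rabs_pos_eq; lra).
apply Rbar_not_lt_le; intros Hlt; rewrite <- Hq in Hlt.
apply (CV_disk_outside _ _ Hlt).
specialize (Hf ((Rabs h + r) / 2) ltac:(lra)).
apply is_lim_seq_ext with (fun n => scal (pow_n ((Rabs h + r) / 2) n) (a n)).
- intros n; rewrite pow_n_pow; apply Rmult_comm.
- apply (ex_series_lim_0); eexists; exact Hf.
Qed.

Lemma real_analytic_ext (f g : R -> R) (x r : R) :
  0 < r -> (forall h, Rabs h < r -> f (x + h) = g (x + h)) ->
  real_analytic_at f x -> real_analytic_at g x.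
Proof.
intros Hr Hfg [a [r' [Hr' Ha]]]; exists a, (Rmin r r'); split; [now apply Rmin_pos|].
intros h Hh; rewrite <- Hfg; [apply Ha|]; eapply Rlt_le_trans; try exact Hh;
  [apply Rmin_r|apply Rmin_l].
Qed.

Lemma real_analytic_plus (f g : R -> R) (x : R) :
  real_analytic_at f x -> real_analytic_at g x -> real_analytic_at (fun s => f s + g s) x.
Proof.
intros [a [r [Hr Ha]]] [b [r' [Hr' Hb]]].
exists (PS_plus a b), (Rmin r r'); split; [now apply Rmin_pos|].
intros h Hh; apply (is_pseries_plus (K := R_AbsRing) (V := R_NormedModule));
  [apply Ha|apply Hb]; eapply Rlt_le_trans; try exact Hh; [apply Rmin_l|apply Rmin_r].
Qed.

Lemma real_analytic_mult (f g : R -> R) (x : R) :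
  real_analytic_at f x -> real_analytic_at g x -> real_analytic_at (fun s => f s * g s) x.
Proof.
intros [a [r [Hr Ha]]] [b [r' [Hr' Hb]]].
exists (PS_mult a b), (Rmin r r'); split; [now apply Rmin_pos|].
intros h Hh.
assert (Rabs h < r) by (eapply Rlt_le_trans; [exact Hh|apply Rmin_l]).
assert (Rabs h < r') by (eapply Rlt_le_trans; [exact Hh|apply Rmin_r]).
apply is_pseries_mult; auto.
- now apply (CV_radius_gt a (fun h => f (x + h)) r).
- now apply (CV_radius_gt b (fun h => g (x + h)) r').
Qed.

Lemma is_pseries_affine (c d h : R) :
  is_pseries (fun k => match k with 0%nat => c | 1%nat => d | _ => 0 end) h (c + d * h).
Proof.
set (a := fun k => match k with 0%nat => c | 1%nat => d | _ => 0 end).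
change (is_lim_seq (sum_n (fun k => scal (pow_n h k) (a k))) (c + d * h)).
apply is_lim_seq_incr_1.
apply is_lim_seq_ext with (fun _ => c + d * h); [|apply is_lim_seq_const].
induction n as [|n IH]; rewrite sum_Sn.
- rewrite sum_O; unfold scal, plus, mult; simpl; unfold mult, one; simpl; ring.
- rewrite <- IH; unfold scal, plus, mult; simpl; unfold mult; simpl; ring.
Qed.

Lemma real_analytic_affine (c d x : R) : real_analytic_at (fun s => c + d * s) x.
Proof.
eexists; exists 1; split; [lra|]; intros h _.
replace (c + d * (x + h)) with ((c + d * x) + d * h) by ring.
apply is_pseries_affine.
Qed.

Lemma real_analytic_pow (f : R -> R) (x : R) (m : nat) :
  real_analytic_at f x -> real_analytic_at (fun s => f s ^ m) x.
Proof.
intros Hf; induction m as [|m IH].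
- apply (real_analytic_ext (fun s => 1 + 0 * s) _ x 1); [lra| |apply real_analytic_affine].
  intros; simpl; ring.
- now apply (real_analytic_mult f).
Qed.

Lemma real_analytic_minus (f g : R -> R) (x : R) :
  real_analytic_at f x -> real_analytic_at g x -> real_analytic_at (fun s => f s - g s) x.
Proof.
intros Hf Hg.
apply (real_analytic_ext (fun s => f s + (-1 + 0 * s) * g s) _ x 1); [lra|intros; ring|].
apply real_analytic_plus; [assumption|].
now apply real_analytic_mult; [apply real_analytic_affine|].
Qed.

Lemma pseries_coef_0_eq_0 (r : R) (a : nat -> R) :
  0 < r -> (forall h, 0 < h < r -> is_pseries a h 0) -> a 0%nat = 0.
Proof.
intros Hr Ha.
assert (Hcv : Rbar_lt (Rabs 0) (CV_radius a)).
{ apply Rbar_lt_le_trans with (Finite (r / 2)); [rewrite Rabs_R0; simpl; lra|].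
  apply Rbar_not_lt_le; intros Hlt.
  rewrite <- (Rabs_pos_eq (r / 2)) in Hlt by lra.
  apply (CV_disk_outside _ _ Hlt).
  apply is_lim_seq_ext with (fun n => scal (pow_n (r / 2) n) (a n)).
  - intros n; rewrite pow_n_pow; apply Rmult_comm.
  - apply (ex_series_lim_0); eexists; apply Ha; lra. }
pose proof (PSeries_continuity a 0 Hcv) as Hc.
rewrite <- (PSeries_0 a).
apply continuity_pt_filterlim in Hc.
assert (Hlim : is_lim_seq (fun n => r / 2 * / INR (S n)) 0).
{ replace (Finite 0) with (Finite (r / 2 * 0)) by (f_equal; ring).
  apply (is_lim_seq_scal_l _ _ 0), is_lim_seq_inv_INR_S. }
pose proof (filterlim_comp _ _ _ _ _ _ _ _ Hlim Hc) as HL.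
assert (H0 : is_lim_seq (fun n => PSeries a (r / 2 * / INR (S n))) 0).
{ apply is_lim_seq_ext with (fun _ => 0); [|apply is_lim_seq_const].
  intros n; symmetry; apply is_pseries_unique, Ha.
  pose proof (INR_S_ge_1 n).
  assert (0 < / INR (S n) <= 1).
  { split; [apply Rinv_0_lt_compat; lra|]. rewrite <- Rinv_1; apply Rinv_le_contravar; lra. }
  nra. }
apply is_lim_seq_unique in H0.
assert (H1 : is_lim_seq (fun n => PSeries a (r / 2 * / INR (S n))) (PSeries a 0)) by exact HL.
apply is_lim_seq_unique in H1; rewrite H1 in H0; now injection H0.
Qed.

(** [a] is quantified after [n] because the induction passes to the shifted coefficients, that is,
    to the series divided by [h]. Data at [h > 0] suffice: the constant coefficient is a one-sided
    limit. *)
Lemma pseries_coef_eq_0 (r : R) (n : nat) : 0 < r -> forall a,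
  (forall h, 0 < h < r -> is_pseries a h 0) -> a n = 0.
Proof.
intros Hr; induction n as [|n IH]; intros a Ha; [now apply (pseries_coef_0_eq_0 r)|].
apply (IH (PS_decr_1 a)); intros h Hh.
replace 0 with (scal (/ h) (plus 0 (opp (a 0%nat)))).
- apply (is_pseries_decr_1 (K := R_AbsRing) (V := R_NormedModule)); [|now apply Ha].
  unfold mult, one; simpl; field; lra.
- rewrite (pseries_coef_0_eq_0 r a Hr Ha).
  unfold scal, plus, opp; simpl; unfold mult; simpl; ring.
Qed.

(** Vanishing on the right kills all Taylor coefficients, so the zero set reaches across [x] to the
    left. *)
Lemma real_analytic_zero_right (f : R -> R) (x r : R) :
  real_analytic_at f x -> 0 < r -> (forall s, x < s < x + r -> f s = 0) ->
  exists r', 0 < r' /\ forall s, x - r' < s < x + r' -> f s = 0.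
Proof.
intros [a [r' [Hr' Ha]]] Hr Hf; exists r'; split; [assumption|]; intros s Hs.
assert (Ha0 : forall k, a k = 0).
{ intros k; apply (pseries_coef_eq_0 (Rmin r r')); [now apply Rmin_pos|].
  intros h Hh; pose proof (Rmin_l r r'); pose proof (Rmin_r r r').
  rewrite <- (Hf (x + h)) by lra; apply Ha; rewrite Rabs_pos_eq; lra. }
assert (Hs' : is_pseries a (s - x) (f s)).
{ replace s with (x + (s - x)) at 2 by ring; apply Ha, Rabs_def1; lra. }
apply is_pseries_unique in Hs'; rewrite <- Hs'.
rewrite (PSeries_ext a (fun _ => 0) _ Ha0); apply PSeries_const_0.
Qed.

(** Connectedness by a supremum: [E] holds the lengths of intervals ending at [d] on which [f]
    vanishes, capped so that their left ends stay at or above [s0]. If the supremum stopped short of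
    [s0], [real_analytic_zero_right] would extend it. *)
Lemma real_analytic_zero_left (f : R -> R) (x c d : R) :
  x < c < d -> (forall s, x < s < d -> real_analytic_at f s) ->
  (forall s, c < s < d -> f s = 0) -> forall s, x < s < d -> f s = 0.
Proof.
intros Hc Hf H0 s0 Hs0.
set (E := fun e => e <= d - s0 /\ forall s, d - e < s < d -> f s = 0).
destruct (completeness E) as [e [Hub Hlub]].
- exists (d - s0); intros e He; apply He.
- exists (Rmin (d - c) (d - s0)); split; [apply Rmin_r|].
  intros s Hs; apply H0; pose proof (Rmin_l (d - c) (d - s0)); lra.
- assert (Hpos : Rmin (d - c) (d - s0) <= e).
  { apply Hub; split; [apply Rmin_r|].
    intros s Hs; apply H0; pose proof (Rmin_l (d - c) (d - s0)); lra. }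
  assert (He : 0 < e) by (eapply Rlt_le_trans; [|exact Hpos]; apply Rmin_pos; lra).
  assert (Hed : e <= d - s0) by (apply Hlub; intros e' He'; apply He').
  assert (Hright : forall s, d - e < s < d -> f s = 0).
  { intros s Hs; destruct (classic (f s = 0)) as [|Hn]; [assumption|exfalso].
    assert (e <= d - s); [|lra]; apply Hlub; intros e' [_ He'].
    destruct (Rle_or_lt e' (d - s)); [assumption|exfalso; apply Hn, He'; lra]. }
  destruct (real_analytic_zero_right f (d - e) e) as [r [Hr Hz]];
    [apply Hf; lra|assumption|intros s Hs; apply Hright; lra|].
  destruct (Req_dec (d - e) s0) as [<-|Hne]; [apply Hz; lra|exfalso].
  assert (Hmin := Rmin_pos r (d - e - s0) Hr ltac:(lra)).
  pose proof (Rmin_l r (d - e - s0)); pose proof (Rmin_r r (d - e - s0)).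
  assert (e + Rmin r (d - e - s0) <= e); [|lra].
  apply Hub; split; [lra|]; intros s Hs.
  destruct (Rlt_or_le (d - e) s); [apply Hright|apply Hz]; lra.
Qed.

(** Since [ln t >= 0] on the range of integration, the coefficients [I n k] are nonnegative and the
    series of absolute values sums to [Phi (c - |h|)]. It converges as long as [|h| < c], which is
    the radius claimed. *)
Lemma real_analytic_Phi (c : R) : 0 < c -> real_analytic_at Phi c.
Proof.
intros Hc.
set (I := fun n k => RInt (fun t => bern n t * Rpower t (- c - 2) * (ln t ^ k / INR (fact k)))
                       (INR (S n)) (INR (S n) + 1)).
assert (HI : forall n k, 0 <= I n k).
{ intros n k; pose proof (INR_S_ge_1 n); apply RInt_ge_0; [lra| |].
  - apply ex_RInt_unit; intros t Ht; apply (continuous_mult (K := R_AbsRing)).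
    + now apply continuous_bern_Rpower.
    + apply (ex_derive_continuous (V := R_NormedModule)); auto_derive; trivial.
  - intros t Ht; apply Rmult_le_pos; [apply Rmult_le_pos|].
    + apply bern_bounds; lra.
    + left; apply Rpower_pos.
    + apply Rmult_le_pos; [apply pow_le|left; apply Rinv_0_lt_compat, INR_fact_lt_0].
      rewrite <- ln_1; apply ln_le; lra. }
assert (Hser : forall n h, is_series (fun k => h ^ k * I n k) (Phi_n n (c - h))).
{ intros n h; generalize (is_pseries_Phi_n n c h); apply is_series_ext.
  intros k; rewrite <- pow_n_pow; reflexivity. }
(* The expansion of [Phi_n] is in powers of [h] at [c - h]; going to [c + h] alternates the
   signs. *)
exists (fun k => (-1) ^ k * Series (fun n => I n k)), c; split; [assumption|].
intros h Hh.
assert (HF : is_series (fun k => Series (fun n => (- h) ^ k * I n k)) (Phi (c - - h))).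
{ apply is_series_Fubini with (fun n k => Rabs h ^ k * I n k) (fun n => Phi_n n (c - Rabs h)).
  - intros n k; rewrite Rabs_mult, <- RPow_abs, Rabs_Ropp, (Rabs_pos_eq (I n k)) by apply HI.
    apply Rle_refl.
  - intros n; apply Hser.
  - intros n; apply Hser.
  - apply ex_series_Phi; lra. }
replace (c + h) with (c - - h) by ring.
revert HF; apply is_series_ext; intros k.
rewrite Series_scal_l.
replace (- h) with (-1 * h) by ring; rewrite Rpow_mult_distr, <- (pow_n_pow h k).
rewrite (Rmult_comm ((-1) ^ k)), Rmult_assoc; reflexivity.
Qed.

Lemma Re_sum_n (u : nat -> C) (N : nat) :
  Re (sum_n (G := C_AbelianMonoid) u N) = sum_n (fun n => Re (u n)) N.
Proof.
induction N as [|N IH]; [now rewrite !sum_O|].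
rewrite !sum_Sn, <- IH; reflexivity.
Qed.

Lemma is_series_Re (u : nat -> C) (l : C) :
  is_series (K := C_AbsRing) (V := C_NormedModule) u l ->
  is_series (fun n => Re (u n)) (Re l).
Proof.
intros Hu.
assert (Hre : filterlim (Re : C -> R) (locally (T := C_NormedModule) l) (locally (Re l))).
{ intros P [e He]; exists e; intros z Hz; apply He, Hz. }
pose proof (filterlim_comp _ _ _ _ _ _ _ _ Hu Hre) as H.
eapply filterlim_ext; [|exact H]; intros N; apply (Re_sum_n u N).
Qed.

Lemma Re_RtoC_mult (x : R) (z : C) : Re (RtoC x * z)%C = x * Re z.
Proof. unfold Re, Cmult; simpl; ring. Qed.

Lemma pow_n_RtoC (h : R) (k : nat) : pow_n (K := C_AbsRing) (RtoC h) k = RtoC (h ^ k).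
Proof.
induction k as [|k IH]; [reflexivity|].
simpl pow_n; rewrite IH; symmetry; apply (RtoC_mult h (h ^ k)).
Qed.

Lemma is_pseries_Re (a : nat -> C) (h : R) (l : C) :
  is_pseries (K := C_AbsRing) (V := C_NormedModule) a (RtoC h) l ->
  is_pseries (fun k => Re (a k)) h (Re l).
Proof.
intros Ha; apply is_series_Re in Ha; revert Ha; apply is_series_ext; intros k.
rewrite pow_n_RtoC, <- (pow_n_pow h k); apply Re_RtoC_mult.
Qed.

Lemma real_analytic_on_reals (f : C -> C) (x : R) :
  analytic_at f (RtoC x) -> real_analytic_at (on_reals f) x.
Proof.
intros [a [r [Hr Ha]]]; exists (fun k => Re (a k)), r; split; [assumption|].
intros h Hh; apply is_pseries_Re.
replace (RtoC h) with (RtoC (x + h) - RtoC x)%C by (rewrite <- RtoC_minus; f_equal; ring).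
apply Ha; rewrite <- RtoC_minus, Cmod_R.
now replace (x + h - x) with h by ring.
Qed.

Lemma Rcpow_real (n : nat) (s : R) :
  Re (Rcpow (INR (S n)) (- RtoC s)) = Rpower (INR (S n)) (- s).
Proof.
unfold Rcpow, Cexp, Rpower; rewrite <- RtoC_opp, <- RtoC_mult.
unfold Re, Im, RtoC; cbv [fst snd]; rewrite cos_0; ring.
Qed.

Lemma zeta_real_gt_1 (zeta : C -> C) (s : R) :
  is_Riemann_zeta zeta -> 1 < s -> on_reals zeta s = zeta_EM s.
Proof.
intros [Hz _] Hs; specialize (Hz (RtoC s) Hs); apply is_series_Re in Hz.
apply is_series_unique in Hz; unfold on_reals; rewrite <- Hz.
rewrite <- (is_series_unique _ _ (is_series_zeta_EM s Hs)).
apply Series_ext; intros n; apply Rcpow_real.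
Qed.

(** The equality known on [s > 1] has to cross the pole. [D] is [(s-1)] times the difference to be
    killed; [D1] equals [(s-1)^m D] away from 1 but is built from [g], hence analytic at 1. It
    vanishes to the right of 1, so also just to the left, where [(s-1)^m] can be cancelled; from
    there the zero spreads over (0, 1). *)
Lemma zeta_real_lt_1 (zeta : C -> C) (s : R) :
  is_Riemann_zeta zeta -> 0 < s < 1 -> on_reals zeta s = zeta_EM s.
Proof.
intros Hz Hs; pose proof (fun s => zeta_real_gt_1 zeta s Hz) as Hgt.
destruct Hz as [_ [Han [m [g [r [Hg [Hr Hgz]]]]]]].
(* The polynomial factors are spelled [c + d * s] to match [real_analytic_affine]. *)
set (E := fun s => (1 / 2 + 1 / 2 * s) + (-1 + 1 * s) * (0 + 1 * s) * (1 + 1 * s) * Phi s).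
assert (HE : forall s, s <> 1 -> E s = (s - 1) * zeta_EM s).
{ intros t Ht; unfold E, zeta_EM; field; lra. }
assert (HEan : forall s, 0 < s -> real_analytic_at E s).
{ intros t Ht; apply real_analytic_plus; [apply real_analytic_affine|].
  apply real_analytic_mult; [|now apply real_analytic_Phi].
  apply real_analytic_mult; [apply real_analytic_mult|]; apply real_analytic_affine. }
set (D := fun s => (-1 + 1 * s) * on_reals zeta s - E s).
set (D1 := fun s => (-1 + 1 * s) * on_reals g s - (-1 + 1 * s) ^ m * E s).
assert (HD1 : forall s, 0 < Rabs (s - 1) < r -> D1 s = (s - 1) ^ m * D s).
{ intros t Ht; unfold D1, D.
  assert (Hgt' : on_reals g t = (t - 1) ^ m * on_reals zeta t).
  { unfold on_reals; rewrite Hgz, <- RtoC_minus, <- RtoC_pow.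
    - apply Re_RtoC_mult.
    - now rewrite <- RtoC_minus, Cmod_R. }
  rewrite Hgt'; replace (-1 + 1 * t) with (t - 1) by ring; ring. }
destruct (real_analytic_zero_right D1 1 r) as [r' [Hr' HD0]]; [|assumption| |].
- apply real_analytic_minus; apply real_analytic_mult.
  + apply real_analytic_affine.
  + now apply real_analytic_on_reals.
  + apply real_analytic_pow, real_analytic_affine.
  + apply HEan; lra.
- intros t Ht; rewrite HD1 by (rewrite Rabs_pos_eq; lra).
  unfold D; rewrite Hgt, HE by lra; ring.
- assert (HDs : D s = 0).
  { set (e := Rmin (Rmin r r') 1).
    assert (0 < e) by (repeat apply Rmin_pos; lra).
    assert (e <= r /\ e <= r' /\ e <= 1).
    { unfold e; pose proof (Rmin_l (Rmin r r') 1); pose proof (Rmin_r (Rmin r r') 1).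
      pose proof (Rmin_l r r'); pose proof (Rmin_r r r'); lra. }
    apply (real_analytic_zero_left D 0 (1 - e / 2) 1); [lra| | |lra].
    - intros t Ht; apply real_analytic_minus; [|apply HEan; lra].
      apply real_analytic_mult; [apply real_analytic_affine|].
      apply real_analytic_on_reals, Han; intros Heq; injection Heq; lra.
    - intros t Ht; apply Rmult_eq_reg_l with ((t - 1) ^ m); [|apply pow_nonzero; lra].
      rewrite <- HD1, Rmult_0_r by (rewrite Rabs_left; lra).
      apply HD0; lra. }
  unfold D in HDs; rewrite HE in HDs by lra.
  apply Rmult_eq_reg_l with (s - 1); lra.
Qed.

(** * Monotonicity of y (y - 1) Phi y *)

Definition Ref_n (n : nat) (y : R) : R :=
  RInt (fun t => (t - 1) / t * Rpower t (- y - 2)) (INR (S n)) (INR (S n) + 1).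

Lemma continuous_ref_Rpower (a t : R) :
  0 < t -> continuous (fun u => (u - 1) / u * Rpower u a) t.
Proof.
intros Ht; apply (ex_derive_continuous (V := R_NormedModule)).
unfold Rpower; auto_derive; lra.
Qed.

Lemma ex_RInt_ref_Rpower (n : nat) (a : R) :
  ex_RInt (fun t => (t - 1) / t * Rpower t a) (INR (S n)) (INR (S n) + 1).
Proof. apply ex_RInt_unit; intros t; apply continuous_ref_Rpower. Qed.

Lemma is_series_Ref (y : R) :
  0 <= y -> is_series (fun n => Ref_n n y) (/ ((y + 1) * (y + 2))).
Proof.
intros Hy.
set (G := fun n => Rpower (INR (S n)) (- y - 1) / (y + 1) - Rpower (INR (S n)) (- y - 2) / (y + 2)).
apply (is_series_ext (fun n => G n - G (S n))).
- intros n; symmetry; pose proof (INR_S_ge_1 n).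
  unfold G; rewrite (S_INR (S n)); set (m := INR (S n)) in *.
  pose (K := fun t => Rpower t (- y - 2) * (1 / (y + 2) - t / (y + 1))).
  replace (_ - _ - (_ - _)) with (K (m + 1) - K m).
  + apply is_RInt_unique, is_RInt_antiderivative; [lra| |].
    * intros t Ht; unfold K, Rpower; auto_derive; [lra|field; lra].
    * intros t Ht; apply continuous_ref_Rpower; lra.
  + unfold K; rewrite <- (Rpower_minus_nat m (- y - 1) 1),
      <- (Rpower_minus_nat (m + 1) (- y - 1) 1) by lra.
    replace (- y - 1 - INR 1) with (- y - 2) by (simpl; ring).
    field; lra.
- replace (/ _) with (G 0%nat - 0)
    by (unfold G; change (INR 1) with 1; rewrite !Rpower_1_l; field; lra).
  apply is_series_telescope.
  replace (Finite 0) with (Finite (0 / (y + 1) - 0 / (y + 2))) by (f_equal; field; lra).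
  apply is_lim_seq_minus'.
  + apply (is_lim_seq_scal_r _ (/ (y + 1)) 0), is_lim_seq_Rpower_neg; lra.
  + apply (is_lim_seq_scal_r _ (/ (y + 2)) 0), is_lim_seq_Rpower_neg; lra.
Qed.

(** With [u = t - m] the worst case is [m = 2], where the ratio [u (1-u) (2+u) / (2 (1+u))] peaks at
    about 0.2093. The constant must exceed this and stay below [6 * Phi 1], about 0.2316. *)
Lemma bern_le_ref (n : nat) (t : R) :
  INR (S (S n)) <= t <= INR (S (S n)) + 1 -> bern (S n) t <= 21 / 100 * ((t - 1) / t).
Proof.
intros Ht; unfold bern; set (m := INR (S (S n))) in *.
assert (Hm : 2 <= m) by (unfold m; rewrite S_INR; pose proof (INR_S_ge_1 n); lra).
set (u := t - m).
apply Rle_trans with (21 / 100 * ((1 + u) / (2 + u))).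
- assert (Hu : 0 <= u <= 1) by (unfold u; lra).
  replace (m + 1 - t) with (1 - u) by (unfold u; ring).
  apply Rmult_le_reg_r with (2 + u); [lra|].
  replace (21 / 100 * ((1 + u) / (2 + u)) * (2 + u)) with (21 / 100 * (1 + u)) by (field; lra).
  (* 93/200 approximates the double root of the cubic at the optimal constant. *)
  assert (0 <= (u - 93 / 200) ^ 2 * (u + 1 + 93 / 100)) by
    (apply Rmult_le_pos; [apply pow2_ge_0|lra]).
  nra.
- apply Rmult_le_compat_l; [lra|].
  assert (Hut : 2 + u <= t) by (unfold u; lra).
  assert (0 <= u) by (unfold u; lra).
  replace ((t - 1) / t) with (1 - / t) by (field; lra).
  replace ((1 + u) / (2 + u)) with (1 - / (2 + u)) by (field; lra).
  assert (/ t <= / (2 + u)) by (apply Rinv_le_contravar; lra); lra.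
Qed.

(** The last factor shows the only sign change beyond [t = 1], at [t = 1 + sqrt (1 - 2 l)]. *)
Lemma bern_0_ref (l t : R) : 0 < t ->
  bern 0 t - l * ((t - 1) / t) = (t - 1) / (2 * t) * (1 - 2 * l - (t - 1) ^ 2).
Proof. intros Ht; unfold bern; simpl; field; lra. Qed.

(** 1/2 is the largest ratio of the kernel to the weight, approached as [t] tends to 1. The bound
    keeps the level [l] of [Phi_crossing] at most 1/2, so that its square root makes sense. *)
Lemma Phi_le_ref (y : R) : 0 <= y -> Phi y <= / 2 * / ((y + 1) * (y + 2)).
Proof.
intros Hy; pose proof (is_series_Ref y Hy) as HR.
rewrite <- (is_series_unique _ _ HR), <- Series_scal_l.
apply Series_le;
  [|eexists; apply (is_series_scal (K := R_AbsRing) (V := R_NormedModule) (/ 2)), HR].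
intros n; split; [left; apply Phi_n_gt_0|].
unfold Ref_n; rewrite <- (RInt_scal (V := R_CompleteNormedModule)) by apply ex_RInt_ref_Rpower.
apply RInt_le; [lra|apply ex_RInt_bern_Rpower| |].
- apply (ex_RInt_scal (V := R_NormedModule)), ex_RInt_ref_Rpower.
- intros t Ht; pose proof (INR_S_ge_1 n).
  change (bern n t * Rpower t (- y - 2) <= / 2 * ((t - 1) / t * Rpower t (- y - 2))).
  rewrite <- Rmult_assoc; apply Rmult_le_compat_r; [left; apply Rpower_pos|].
  assert (0 <= (t - 1) / t) by (apply Rmult_le_pos; [lra|left; apply Rinv_0_lt_compat; lra]).
  destruct n as [|n].
  + apply Rminus_le; rewrite bern_0_ref by lra.
    assert (0 <= (t - 1) / (2 * t))
      by (apply Rmult_le_pos; [lra|left; apply Rinv_0_lt_compat; lra]).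
    pose proof (pow2_ge_0 (t - 1)); nra.
  + eapply Rle_trans; [apply bern_le_ref; lra|lra].
Qed.

(* On [1, 2] the kernel [bern] exceeds [l] times the reference weight [(t - 1) / t] exactly
   up to [t0 = 1 + sqrt (1 - 2 l)], and beyond [2] it never does. Multiplying by the
   decreasing factor [t^-(z - y)] therefore favours the positive part. *)
Lemma Phi_crossing (y z l : R) :
  0 <= y <= z -> 21 / 100 <= l <= 1 / 2 ->
  l * / ((y + 1) * (y + 2)) <= Phi y -> l * / ((z + 1) * (z + 2)) <= Phi z.
Proof.
intros Hy Hl Hly.
set (t0 := 1 + sqrt (1 - 2 * l)).
assert (Hs0 : 0 <= sqrt (1 - 2 * l)) by apply sqrt_pos.
assert (Hs2 : sqrt (1 - 2 * l) ^ 2 = 1 - 2 * l) by (apply pow2_sqrt; lra).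
(* [th] is the value of the decreasing factor at the crossing point. The kernel difference and
   [t^-(z-y) - th] never have opposite signs, so putting [th] for the factor can only lower the
   integrand. *)
set (th := Rpower t0 (- (z - y))).
assert (Hth : 0 < th) by apply Rpower_pos.
assert (Hpt : forall n t, INR (S n) < t < INR (S n) + 1 ->
  th * (bern n t - l * ((t - 1) / t)) * Rpower t (- y - 2) <=
  (bern n t - l * ((t - 1) / t)) * Rpower t (- z - 2)).
{ intros n t Ht; pose proof (INR_S_ge_1 n).
  replace (Rpower t (- z - 2)) with (Rpower t (- (z - y)) * Rpower t (- y - 2))
    by (rewrite <- Rpower_plus; f_equal; ring).
  rewrite <- Rmult_assoc; apply Rmult_le_compat_r; [left; apply Rpower_pos|].
  assert (Hanti : forall a b, 0 < a <= b -> Rpower b (- (z - y)) <= Rpower a (- (z - y))).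
  { intros a b Hab; rewrite !Rpower_Ropp; apply Rinv_le_contravar; [apply Rpower_pos|].
    apply Rle_Rpower_l; lra. }
  assert (Hsign : (t <= t0 /\ 0 <= bern n t - l * ((t - 1) / t)) \/
                  (t0 <= t /\ bern n t - l * ((t - 1) / t) <= 0)).
  { assert (0 <= (t - 1) / t) by (apply Rmult_le_pos; [lra|left; apply Rinv_0_lt_compat; lra]).
    destruct n as [|n].
    - rewrite bern_0_ref by lra.
      assert (0 <= (t - 1) / (2 * t))
        by (apply Rmult_le_pos; [lra|left; apply Rinv_0_lt_compat; lra]).
      destruct (Rle_or_lt t t0) as [Htt|Htt]; [left|right]; (split; [lra|]); unfold t0 in Htt.
      + apply Rmult_le_pos; [assumption|]; nra.
      + apply Rmult_le_0_l; [assumption|]; nra.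
    - right; split.
      + unfold t0; assert (sqrt (1 - 2 * l) <= 1) by nra.
        rewrite S_INR in Ht; pose proof (INR_S_ge_1 n); lra.
      + pose proof (bern_le_ref n t ltac:(lra)); nra. }
  destruct Hsign as [[H1 H2]|[H1 H2]].
  - pose proof (Hanti t t0 ltac:(lra)); unfold th; nra.
  - pose proof (Hanti t0 t ltac:(unfold t0 in *; lra)); unfold th; nra. }
assert (Hn : forall n, th * (Phi_n n y - l * Ref_n n y) <= Phi_n n z - l * Ref_n n z).
{ intros n.
  assert (HI : forall s, is_RInt (fun t => (bern n t - l * ((t - 1) / t)) * Rpower t (- s - 2))
     (INR (S n)) (INR (S n) + 1) (Phi_n n s - l * Ref_n n s)).
  { intros s; apply (is_RInt_ext (fun t => minus (bern n t * Rpower t (- s - 2))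
        (scal l ((t - 1) / t * Rpower t (- s - 2))))).
    - intros t _; unfold minus, plus, opp, scal; simpl; unfold mult; simpl; ring.
    - apply (is_RInt_minus (V := R_NormedModule)); [|apply (is_RInt_scal (V := R_NormedModule))];
        apply (RInt_correct (V := R_CompleteNormedModule)).
      + apply ex_RInt_bern_Rpower.
      + apply ex_RInt_ref_Rpower. }
  apply (is_RInt_le (fun t => th * ((bern n t - l * ((t - 1) / t)) * Rpower t (- y - 2)))
    (fun t => (bern n t - l * ((t - 1) / t)) * Rpower t (- z - 2)) (INR (S n)) (INR (S n) + 1)).
  - lra.
  - apply (is_RInt_scal (V := R_NormedModule)), HI.
  - apply HI.
  - intros t Ht; rewrite <- Rmult_assoc; now apply Hpt. }
assert (HS : forall s, 0 <= s ->
  is_series (fun n => Phi_n n s - l * Ref_n n s) (Phi s - l * / ((s + 1) * (s + 2)))).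
{ intros s Hs; apply (is_series_minus (V := R_NormedModule)).
  - now apply Series_correct, ex_series_Phi.
  - apply (is_series_scal (K := R_AbsRing) (V := R_NormedModule) l), is_series_Ref, Hs. }
assert (Hfin : th * (Phi y - l * / ((y + 1) * (y + 2))) <= Phi z - l * / ((z + 1) * (z + 2))).
{ refine (is_lim_seq_le _ _ (Finite _) (Finite _) _
    (is_series_scal (K := R_AbsRing) (V := R_NormedModule) th _ _ (HS y ltac:(lra)))
    (HS z ltac:(lra))).
  intros N; apply sum_n_m_le; intros n; apply Hn. }
assert (0 <= th * (Phi y - l * / ((y + 1) * (y + 2)))) by (apply Rmult_le_pos; lra).
lra.
Qed.

(** The Taylor polynomial of degree 4 of [exp] at 0.694 is about 2.0002. [Phi_1_ge] needs [ln 2]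
    below roughly 0.69417. *)
Lemma ln_2_le : ln 2 <= 347 / 500.
Proof.
apply Rnot_lt_le; intros Hlt; apply exp_increasing in Hlt; rewrite exp_ln in Hlt by lra.
assert (H : sum_n (fun k => (347 / 500) ^ k * / INR (fact k)) 4 <= exp (347 / 500)).
{ pose proof (is_exp_Reals (347 / 500)) as He.
  assert (He' : is_series (fun k => (347 / 500) ^ k * / INR (fact k)) (exp (347 / 500))).
  { revert He; apply is_series_ext; intros k; rewrite <- (pow_n_pow (347 / 500) k); reflexivity. }
  rewrite <- (is_series_unique _ _ He'); apply sum_n_le_Series; [|eexists; exact He'].
  intros k; apply Rmult_le_pos; [apply pow_le; lra|].
  left; apply Rinv_0_lt_compat, INR_fact_lt_0. }
rewrite !sum_Sn, sum_O in H; unfold plus in H; simpl in H; lra.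
Qed.

(** The limit case that [Phi_n_closed] excludes: at [s = 1] a logarithm replaces the quotient by
    [s - 1]. *)
Lemma Phi_n_1 (n : nat) :
  2 * Phi_n n 1 = (/ INR (S n) + / INR (S (S n))) / 2 - (ln (INR (S (S n))) - ln (INR (S n))).
Proof.
pose proof (INR_S_ge_1 n); rewrite (S_INR (S n)); set (m := INR (S n)) in *.
pose (G := fun t => - bern n t / t ^ 2 - (m + / 2 - t) / t - ln t).
assert (HI : is_RInt (fun t => 2 * (bern n t / t ^ 3)) m (m + 1) (G (m + 1) - G m)).
{ apply is_RInt_antiderivative; [lra| |].
  - intros t Ht; unfold G, bern; fold m; auto_derive; [|field; lra].
    repeat split; try lra; apply Rgt_not_eq; nra.
  - intros t Ht; apply (ex_derive_continuous (V := R_NormedModule)).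
    unfold bern; fold m; auto_derive.
    apply Rgt_not_eq; assert (0 < t) by lra; repeat apply Rmult_lt_0_compat; lra. }
replace (2 * Phi_n n 1) with (G (m + 1) - G m).
- unfold G, bern; fold m; field; lra.
- rewrite <- (is_RInt_unique _ _ _ _ HI); apply is_RInt_unique.
  apply (is_RInt_ext (fun t => scal 2 (bern n t * Rpower t (- 1 - 2)))).
  + rewrite Rmin_left, Rmax_right by lra; intros t Ht.
    replace (- 1 - 2) with (- INR 3) by (simpl; ring).
    rewrite Rpower_Ropp, Rpower_pow by lra; reflexivity.
  + apply (is_RInt_scal (V := R_NormedModule)), (RInt_correct (V := R_CompleteNormedModule)).
    apply ex_RInt_bern_Rpower.
Qed.

(** 7/200 is 21/100 divided by [(1+1)(1+2)]. Two terms fall short of it; with three the logarithms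
    telescope to [ln 4 = 2 ln 2]. *)
Lemma Phi_1_ge : 7 / 200 <= Phi 1.
Proof.
apply Rle_trans with (sum_n (fun n => Phi_n n 1) 2).
- rewrite !sum_Sn, sum_O; change (@plus R_AbelianMonoid) with Rplus.
  pose proof (Phi_n_1 0) as H0; pose proof (Phi_n_1 1) as H1; pose proof (Phi_n_1 2) as H2.
  pose proof ln_2_le as Hln.
  assert (H4 : ln (INR 4) = 2 * ln 2).
  { replace (INR 4) with (2 * 2) by (simpl; ring); rewrite ln_mult by lra; ring. }
  rewrite H4 in H2; change (INR 1) with 1 in H0; rewrite ln_1 in H0.
  replace (INR 4) with 4 in H2 by (simpl; ring).
  replace (INR 3) with 3 in H1, H2 by (simpl; ring).
  replace (INR 2) with 2 in H0, H1 by (simpl; ring).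
  match goal with |- ?x <= ?y => change (Rle x y) end.
  lra.
- apply sum_n_le_Series; [intros n; left; apply Phi_n_gt_0|apply ex_series_Phi; lra].
Qed.

(** [Phi_crossing] at the level [l = Phi y / R0 y] says that [Phi / R0] does not decrease, and
    [s (s-1) R0 s] is a product of two nonnegative increasing factors. *)
Lemma Phi_scaled_incr (y z : R) :
  1 < y <= z -> y * (y - 1) * Phi y <= z * (z - 1) * Phi z.
Proof.
intros Hy.
set (R0 := fun s => / ((s + 1) * (s + 2))).
assert (HR : forall s, 0 <= s -> 0 < R0 s).
{ intros s Hs; apply Rinv_0_lt_compat, Rmult_lt_0_compat; lra. }
(* A first crossing, started at 1, puts the ratio at [y] into the range of levels that the second
   one admits. *)
assert (Hy0 : 21 / 100 * R0 y <= Phi y).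
{ apply (Phi_crossing 1); [lra|lra|]. pose proof Phi_1_ge; lra. }
set (l := Phi y / R0 y).
assert (Hl : Phi y = l * R0 y) by (unfold l; field; apply Rgt_not_eq, HR; lra).
pose proof (HR y ltac:(lra)) as HRy.
assert (Hz : l * R0 z <= Phi z).
{ apply (Phi_crossing y); [lra| |right; symmetry; exact Hl].
  pose proof (Phi_le_ref y ltac:(lra)) as Hle; fold (R0 y) in Hle.
  rewrite Hl in Hy0, Hle; split; apply Rmult_le_reg_r with (R0 y); lra. }
apply Rle_trans with (z * (z - 1) * (l * R0 z)); [|apply Rmult_le_compat_l; nra].
assert (0 <= l).
{ apply Rmult_le_reg_r with (R0 y); [assumption|]; rewrite <- Hl, Rmult_0_l.
  left; apply Phi_gt_0; lra. }
rewrite Hl.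
replace (y * (y - 1) * (l * R0 y)) with (l * (y * (y - 1) * R0 y)) by ring.
replace (z * (z - 1) * (l * R0 z)) with (l * (z * (z - 1) * R0 z)) by ring.
apply Rmult_le_compat_l; [assumption|].
assert (E : forall s, 0 <= s -> s * (s - 1) * R0 s = (1 - / (s + 1)) * (1 - 3 * / (s + 2))).
{ intros s Hs; unfold R0; field; lra. }
rewrite !E by lra.
assert (/ (z + 1) <= / (y + 1)) by (apply Rinv_le_contravar; lra).
assert (/ (z + 2) <= / (y + 2)) by (apply Rinv_le_contravar; lra).
assert (/ (y + 1) <= / 1) by (apply Rinv_le_contravar; lra).
assert (/ (y + 2) <= / 3) by (apply Rinv_le_contravar; lra).
apply Rmult_le_compat; lra.
Qed.

(** * Monotonicity of the sum of reciprocals *)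

(** Here [f] stands for a frozen value of [Phi], and [h] for the summand [w p/(1-p)]. The increment
    factors exactly as [P * d * M], with [2 d] the drop of [w] from [a] to [b]; the sign and size of
    [M] are governed by [1 - 3 a]. *)
Lemma quotient_increment (f a b : R) :
  0 < f <= 1 / 8 -> 0 < a -> a < b -> b < 1 ->
  let q := fun x => 2 * f * x * (1 - x) in
  let h := fun x => (1 - x) / (1 + x) * (q x / (1 - q x)) in
  (1 / 3 <= a -> h b <= h a) /\
  (a < 1 / 3 -> h b - h a <= / 2 * (1 - 3 * a) * ((b - a) / ((1 + a) * (1 + b)))).
Proof.
intros Hf Ha Hab Hb q h.
assert (Hq : forall x, 0 < x < 1 -> 0 <= q x <= 1 / 16).
{ intros x Hx; unfold q.
  assert (0 <= x * (1 - x)) by (apply Rmult_le_pos; lra).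
  pose proof (pow2_ge_0 (x - / 2)); split; nra. }
pose proof (Hq a ltac:(lra)) as Hqa; pose proof (Hq b ltac:(lra)) as Hqb.
set (M := 1 - 2 * a - 2 * b + a * a + b * b - a * b + a * a * b + a * b * b
          + 4 * f * (a * b * (1 - a) * (1 - b))).
assert (HM : M <= (1 - b) * (1 - 3 * a - 2 * a * a + a * a * (1 - a) / 2)).
{ assert (0 <= a * b * (1 - a) * (1 - b)) by (repeat apply Rmult_le_pos; lra).
  assert (4 * f * (a * b * (1 - a) * (1 - b)) <= / 2 * (a * b * (1 - a) * (1 - b)))
    by (apply Rmult_le_compat_r; lra).
  (* [M] is convex in [b]: bound it by its chord between [b = a] and [b = 1]. *)
  assert (0 <= (b - a) * (1 - b) * (1 + a - a * (1 - a) / 2)).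
  { apply Rmult_le_pos; [apply Rmult_le_pos; lra|nra]. }
  assert (0 <= 2 * a * (b - a)) by (apply Rmult_le_pos; lra).
  unfold M; lra. }
set (P := 2 * f / ((1 - q a) * (1 - q b))).
set (d := (b - a) / ((1 + a) * (1 + b))).
assert (HD : 0 < d) by (apply Rdiv_lt_0_compat; [lra|apply Rmult_lt_0_compat; lra]).
assert (HDD : 0 < (1 - q a) * (1 - q b)) by (apply Rmult_lt_0_compat; lra).
assert (HP : 0 < P <= / 2).
{ unfold P; split; [apply Rdiv_lt_0_compat; lra|].
  apply Rmult_le_reg_r with ((1 - q a) * (1 - q b)); [assumption|].
  unfold Rdiv; rewrite Rmult_assoc, Rinv_l by lra; nra. }
assert (HE : h b - h a = P * d * M).
{ unfold h, P, d, M; unfold q in *; field; repeat split; lra. }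
assert (HPd : 0 < P * d) by now apply Rmult_lt_0_compat.
split; intros Ha3.
- assert (M <= 0); [|nra].
  eapply Rle_trans; [exact HM|]; apply Rmult_le_0_l; [lra|nra].
- assert (M <= 1 - 3 * a).
  { eapply Rle_trans; [exact HM|].
    assert (0 <= a * a) by nra.
    apply Rle_trans with ((1 - b) * (1 - 3 * a)); [apply Rmult_le_compat_l; [lra|]|]; nra. }
  rewrite HE; apply Rle_trans with (P * d * (1 - 3 * a)).
  + apply Rmult_le_compat_l; lra.
  + replace (/ 2 * (1 - 3 * a) * d) with (/ 2 * (d * (1 - 3 * a))) by ring.
    rewrite Rmult_assoc; apply Rmult_le_compat_r; [|lra].
    apply Rmult_le_pos; lra.
Qed.

Lemma Rinv_lt_1 (x : R) : 1 < x -> / x < 1.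
Proof. intros Hx; rewrite <- Rinv_1; apply Rinv_lt_contravar; lra. Qed.

(** [defect_lt] and [defect_gt] are the [p] and [e] of the overview: relative deviations of [zeta x]
    and [zeta (1/x)] from the opposite values [-1/(2 w)] and [1/(2 w)], with [w = (1-x)/(1+x)]. *)
Definition defect_lt (x : R) : R := 2 * x * (1 - x) * Phi x.
Definition defect_gt (x : R) : R := 2 * (1 / x) * (1 / x - 1) * Phi (1 / x).

Lemma zeta_EM_defect_lt (x : R) :
  0 < x < 1 -> zeta_EM x = - (1 - defect_lt x) / (2 * ((1 - x) / (1 + x))).
Proof. intros Hx; unfold zeta_EM, defect_lt; field; lra. Qed.

Lemma zeta_EM_defect_gt (x : R) :
  0 < x < 1 -> zeta_EM (1 / x) = (1 + defect_gt x) / (2 * ((1 - x) / (1 + x))).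
Proof. intros Hx; unfold zeta_EM, defect_gt; field; lra. Qed.

Lemma defect_lt_bounds (x : R) :
  0 < x < 1 -> 0 < defect_lt x <= x * (1 - x) / 4 /\ defect_lt x <= 1 / 16.
Proof.
intros Hx; unfold defect_lt.
assert (0 < x * (1 - x)) by (apply Rmult_lt_0_compat; lra).
pose proof (Phi_gt_0 x ltac:(lra)); pose proof (Phi_le x ltac:(lra)).
assert (x * (1 - x) <= / 4) by (pose proof (pow2_ge_0 (x - / 2)); lra).
replace (2 * x * (1 - x) * Phi x) with (x * (1 - x) * (2 * Phi x)) by ring.
assert (x * (1 - x) * (2 * Phi x) <= x * (1 - x) * (1 / 4)) by (apply Rmult_le_compat_l; lra).
repeat split; [apply Rmult_lt_0_compat| |]; lra.
Qed.

Lemma inv_gt_1 (x : R) : 0 < x < 1 -> 1 < 1 / x.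
Proof.
intros Hx; unfold Rdiv; rewrite Rmult_1_l, <- Rinv_1 at 1.
apply Rinv_lt_contravar; lra.
Qed.

Lemma defect_gt_bounds (x : R) :
  0 < x < 1 -> 0 < defect_gt x <= 1 /\ 2 * ((1 - x) / (1 + x)) <= 1 + defect_gt x.
Proof.
intros Hx; pose proof (inv_gt_1 x Hx) as Hy.
assert (Hw : 0 < (1 - x) / (1 + x)) by (apply Rdiv_lt_0_compat; lra).
split.
- unfold defect_gt; set (y := 1 / x) in *.
  pose proof (Phi_gt_0 y ltac:(lra)) as H0; pose proof (Phi_le_ref y ltac:(lra)) as H1.
  assert (0 < 2 * y * (y - 1)) by (apply Rmult_lt_0_compat; lra).
  split; [now apply Rmult_lt_0_compat|].
  apply Rle_trans with (2 * y * (y - 1) * (/ 2 * / ((y + 1) * (y + 2)))).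
  + apply Rmult_le_compat_l; lra.
  + apply Rmult_le_reg_r with ((y + 1) * (y + 2)); [apply Rmult_lt_0_compat; lra|].
    replace (2 * y * (y - 1) * (/ 2 * / ((y + 1) * (y + 2))) * ((y + 1) * (y + 2)))
      with (y * (y - 1)) by (field; lra).
    nra.
- pose proof (zeta_EM_ge_1 (1 / x) Hy) as Hz; rewrite zeta_EM_defect_gt in Hz by assumption.
  apply Rmult_le_reg_r with (/ (2 * ((1 - x) / (1 + x)))).
  + apply Rinv_0_lt_compat; lra.
  + rewrite Rinv_r by lra; exact Hz.
Qed.

(** On (0, 1) the function of the theorem is [-2 * gap] and the harmonic mean is [- / gap], so every
    claim is one about [gap]. *)
Definition gap (x : R) : R :=
  (1 - x) / (1 + x) * (/ (1 - defect_lt x) - / (1 + defect_gt x)).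

Lemma gap_decr (a b : R) : 0 < a -> a < b -> b < 1 -> gap b < gap a.
Proof.
intros Ha Hab Hb.
set (f := Phi a).
assert (Hf : 0 < f <= 1 / 8) by (split; [apply Phi_gt_0|apply Phi_le]; lra).
pose proof (quotient_increment f a b Hf Ha Hab Hb) as HQ; simpl in HQ.
set (q := 2 * f * b * (1 - b)) in HQ.
assert (Hpa : 2 * f * a * (1 - a) = defect_lt a) by (unfold f, defect_lt; ring).
rewrite Hpa in HQ.
assert (Hpb : defect_lt b <= q).
{ unfold defect_lt, q; pose proof (Phi_decr a b ltac:(lra) ltac:(lra)); fold f in H.
  assert (0 < b * (1 - b)) by (apply Rmult_lt_0_compat; lra); nra. }
assert (Hq1 : q <= 1 / 16).
{ unfold q; assert (0 < b * (1 - b)) by (apply Rmult_lt_0_compat; lra).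
  pose proof (pow2_ge_0 (b - / 2)); nra. }
destruct (defect_lt_bounds a ltac:(lra)) as [Ha1 Ha2].
destruct (defect_lt_bounds b ltac:(lra)) as [Hb1 Hb2].
destruct (defect_gt_bounds a ltac:(lra)) as [Ea1 Ea2].
destruct (defect_gt_bounds b ltac:(lra)) as [Eb1 Eb2].
assert (Hee : defect_gt b <= defect_gt a).
{ unfold defect_gt.
  assert (Hi : 1 / b <= 1 / a)
    by (unfold Rdiv; rewrite !Rmult_1_l; apply Rinv_le_contravar; lra).
  pose proof (Phi_scaled_incr (1 / b) (1 / a) (conj (inv_gt_1 b ltac:(lra)) Hi)); lra. }
set (wa := (1 - a) / (1 + a)) in *; set (wb := (1 - b) / (1 + b)) in *.
assert (Hwa : 0 < wa) by (apply Rdiv_lt_0_compat; lra).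
assert (Hwb : 0 < wb) by (apply Rdiv_lt_0_compat; lra).
set (d := (b - a) / ((1 + a) * (1 + b))) in *.
assert (HD : 0 < d) by (apply Rdiv_lt_0_compat; [lra|apply Rmult_lt_0_compat; lra]).
assert (Hw : wa - wb = 2 * d) by (unfold wa, wb, d; field; lra).
set (ua := / (1 + defect_gt a)); set (ub := / (1 + defect_gt b)).
assert (Hu : ua <= ub) by (apply Rinv_le_contravar; lra).
assert (Hub : ub < 1) by (apply Rinv_lt_1; lra).
unfold gap; fold wa wb ua ub.
replace (/ (1 - defect_lt a)) with (defect_lt a / (1 - defect_lt a) + 1) by (field; lra).
replace (/ (1 - defect_lt b)) with (defect_lt b / (1 - defect_lt b) + 1) by (field; lra).
assert (Hqb : defect_lt b / (1 - defect_lt b) <= q / (1 - q)).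
{ unfold Rdiv; apply Rmult_le_compat; [lra|left; apply Rinv_0_lt_compat; lra|lra|].
  apply Rinv_le_contravar; lra. }
apply (Rmult_le_compat_l wb) in Hqb; [|lra].
set (va := defect_lt a / (1 - defect_lt a)) in *; set (vb := defect_lt b / (1 - defect_lt b)) in *.
set (vq := q / (1 - q)) in *.
destruct HQ as [HQ1 HQ2].
destruct (Rle_or_lt (1 / 3) a) as [Ha3|Ha3].
- specialize (HQ1 Ha3).
  assert (wb * (1 - ub) < wa * (1 - ua)); [|nra].
  apply Rlt_le_trans with (wa * (1 - ub)); [apply Rmult_lt_compat_r|apply Rmult_le_compat_l]; lra.
- specialize (HQ2 Ha3).
  (* [zeta (1/a) >= 1] enters here: [1 - 1/(2 wa) = (1-3a) / (2 (1-a))]. Hence the second summand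
     falls by at least [d (1-3a)], twice the bound on the growth of the first. *)
  assert (Hua : ua <= / (2 * wa)) by (apply Rinv_le_contravar; lra).
  assert (H1 : / 2 * (1 - 3 * a) <= 1 - ua).
  { apply Rle_trans with (1 - / (2 * wa)); [|lra].
    replace (1 - / (2 * wa)) with (/ 2 * (1 - 3 * a) * / (1 - a)) by (unfold wa; field; lra).
    rewrite <- (Rmult_1_r (/ 2 * (1 - 3 * a))) at 1.
    apply Rmult_le_compat_l; [lra|]; rewrite <- Rinv_1 at 1; apply Rinv_le_contravar; lra. }
  assert (H2 : wb * (1 - ub) <= wb * (1 - ua)) by (apply Rmult_le_compat_l; lra).
  assert (H3 : (wa - wb) * (1 - ua) = 2 * d * (1 - ua)) by (rewrite Hw; ring).
  assert (H4 : d * (/ 2 * (1 - 3 * a)) <= d * (1 - ua)) by (apply Rmult_le_compat_l; lra).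
  assert (0 < d * (/ 2 * (1 - 3 * a))) by (apply Rmult_lt_0_compat; lra).
  lra.
Qed.

(** Above: [p < x] and [e <= 1] give [w (1/(1-x) - 1/2)], which is exactly 1/2. Below: [p > 0] and
    [1 + e >= 2 w] give [w - 1/2]. The two bounds also squeeze the limit at 0. *)
Lemma gap_bounds (x : R) : 0 < x < 1 -> 0 < gap x < 1 / 2 /\ 1 / 2 - 2 * x <= gap x.
Proof.
intros Hx; unfold gap.
destruct (defect_lt_bounds x Hx) as [[P1 P2] P3].
destruct (defect_gt_bounds x Hx) as [[E1 E2] E3].
set (w := (1 - x) / (1 + x)) in *.
assert (Hw : 0 < w) by (apply Rdiv_lt_0_compat; lra).
assert (Hp : 1 < / (1 - defect_lt x)) by (rewrite <- Rinv_1 at 1; apply Rinv_lt_contravar; lra).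
assert (He : / (1 + defect_gt x) < 1) by (apply Rinv_lt_1; lra).
assert (He2 : / 2 <= / (1 + defect_gt x)) by (apply Rinv_le_contravar; lra).
assert (He3 : / (1 + defect_gt x) <= / (2 * w)) by (apply Rinv_le_contravar; lra).
split; [split|].
- apply Rmult_lt_0_compat; lra.
- assert (Hp2 : / (1 - defect_lt x) < / (1 - x)) by (apply Rinv_lt_contravar; nra).
  apply Rlt_le_trans with (w * (/ (1 - x) - / 2)).
  + apply Rmult_lt_compat_l; lra.
  + right; unfold w; field; lra.
- apply Rle_trans with (w * (1 - / (2 * w))).
  + replace (w * (1 - / (2 * w))) with (/ 2 - 2 * x * / (1 + x)) by (unfold w; field; lra).
    assert (/ (1 + x) <= 1) by (rewrite <- Rinv_1; apply Rinv_le_contravar; lra).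
    nra.
  + apply Rmult_le_compat_l; lra.
Qed.

Theorem theorem2p1 (zeta : C -> C) (Hzeta : is_Riemann_zeta zeta) :
  let z := on_reals zeta in
  let F := fun x : R => (z x + z (1 / x)) / (z x * z (1 / x)) in
  (forall x y : R, 0 < x -> x < y -> y < 1 -> F x < F y) /\
  (forall x y : R, 1 < x -> x < y -> F y < F x) /\
  (forall x : R, 0 < x -> x <> 1 -> harmonic_mean (z x) (z (1 / x)) < -2) /\
  filterlim (fun x : R => harmonic_mean (z x) (z (1 / x)))
    (at_right 0) (locally (-2)).
Proof.
intros z F.
assert (Hzx : forall x, 0 < x < 1 ->
  z x = - (1 - defect_lt x) / (2 * ((1 - x) / (1 + x))) /\
  z (1 / x) = (1 + defect_gt x) / (2 * ((1 - x) / (1 + x)))).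
{ intros x Hx; unfold z.
  rewrite (zeta_real_lt_1 zeta x Hzeta Hx), (zeta_real_gt_1 zeta _ Hzeta (inv_gt_1 x Hx)).
  split; [now apply zeta_EM_defect_lt|now apply zeta_EM_defect_gt]. }
assert (HF : forall x, 0 < x < 1 -> F x = -2 * gap x).
{ intros x Hx; destruct (Hzx x Hx) as [E1 E2]; unfold F, gap; rewrite E1, E2.
  destruct (defect_lt_bounds x Hx); destruct (defect_gt_bounds x Hx).
  field; repeat split; lra. }
assert (HH : forall x, 0 < x < 1 -> harmonic_mean (z x) (z (1 / x)) = - / gap x).
{ intros x Hx; destruct (gap_bounds x Hx) as [Hg _]; pose proof (HF x Hx) as HFx.
  assert (Hz0 : z x <> 0 /\ z (1 / x) <> 0).
  { destruct (Hzx x Hx) as [E1 E2]; rewrite E1, E2.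
    destruct (defect_lt_bounds x Hx); destruct (defect_gt_bounds x Hx).
    assert (0 < (1 - x) / (1 + x)) by (apply Rdiv_lt_0_compat; lra).
    split; unfold Rdiv; apply Rmult_integral_contrapositive_currified; try lra;
      apply Rinv_neq_0_compat; unfold Rdiv in *; lra. }
  (* A zero sum would make [F x] zero, against [F x = -2 * gap x < 0]. *)
  assert (Hs : z x + z (1 / x) <> 0).
  { intros Hs; unfold F in HFx; rewrite Hs in HFx; unfold Rdiv in HFx; lra. }
  replace (- / gap x) with (2 / F x) by (rewrite HFx; field; lra).
  unfold harmonic_mean, F; field; tauto. }
assert (Hinv : forall x, 1 < x -> 0 < 1 / x < 1 /\ 1 / (1 / x) = x).
{ intros x Hx; split; [|field; lra].
  unfold Rdiv; rewrite Rmult_1_l; split; [apply Rinv_0_lt_compat; lra|now apply Rinv_lt_1]. }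
repeat split.
- intros x y Hx Hxy Hy; rewrite !HF by lra; pose proof (gap_decr x y Hx Hxy Hy); lra.
(* [F] is invariant under [x -> 1/x], which reverses order and carries the claim over from (0,
   1). *)
- assert (HFinv : forall x, 1 < x -> F x = -2 * gap (1 / x)).
  { intros x Hx; destruct (Hinv x Hx) as [H1 H2]; rewrite <- HF by assumption.
    unfold F; rewrite H2, Rplus_comm, Rmult_comm; reflexivity. }
  intros x y Hx Hxy; rewrite !HFinv by lra.
  destruct (Hinv x Hx) as [H1 _]; destruct (Hinv y ltac:(lra)) as [H2 _].
  assert (1 / y < 1 / x)
    by (unfold Rdiv; rewrite !Rmult_1_l; apply Rinv_lt_contravar; nra).
  pose proof (gap_decr (1 / y) (1 / x)); lra.
- assert (Hlt : forall x, 0 < x < 1 -> harmonic_mean (z x) (z (1 / x)) < -2).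
  { intros x Hx; rewrite HH by assumption; destruct (gap_bounds x Hx) as [Hg _].
    assert (/ / 2 < / gap x) by (apply Rinv_lt_contravar; lra).
    rewrite Rinv_inv in H; lra. }
  intros x Hx Hx1; destruct (Rlt_or_le x 1) as [Hlt1|Hge]; [apply Hlt; lra|].
  destruct (Hinv x ltac:(lra)) as [H1 H2]; specialize (Hlt _ H1); rewrite H2 in Hlt.
  revert Hlt; unfold harmonic_mean.
  rewrite (Rplus_comm (z (1 / x))), !Rmult_assoc, (Rmult_comm (z (1 / x))); trivial.
- apply (filterlim_ext_loc (fun x => - / gap x)).
  { exists (mkposreal 1 Rlt_0_1); intros x Hx Hx0.
    symmetry; apply HH; split; [assumption|].
    change (Rabs (x - 0) < 1) in Hx; apply Rabs_def2 in Hx; lra. }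
  assert (Hg : filterlim gap (at_right 0) (locally (1 / 2))).
  { apply filterlim_locally; intros eps.
    pose proof (cond_pos eps) as He.
    assert (Hd : 0 < Rmin 1 (eps / 2)) by (apply Rmin_pos; lra).
    exists (mkposreal _ Hd); intros x Hx Hx0.
    change (Rabs (x - 0) < Rmin 1 (eps / 2)) in Hx; apply Rabs_def2 in Hx.
    pose proof (Rmin_l 1 (eps / 2)); pose proof (Rmin_r 1 (eps / 2)).
    destruct (gap_bounds x ltac:(lra)) as [H1 H2].
    change (Rabs (gap x - 1 / 2) < eps); apply Rabs_def1; lra. }
  replace (-2) with (- / (1 / 2)) by field.
  apply (filterlim_comp _ _ _ gap (fun u => - / u) _ _ _ Hg).
  apply (ex_derive_continuous (V := R_NormedModule) (fun u => - / u)); auto_derive; lra.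
Qed.
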